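(* For every $n\ge0$, $m\ge2$ and $x>0$: if $f^{[m]}_n(x)\le f^{[m-1]}_n(x)$, then $$\Delta V^{[m]}_n(x)=\operatorname{med}\big\{f^{[m]}_n(x),\,g(x),\,f^{[m-1]}_n(x)\big\}=\min\Big\{f^{[m-1]}_n(x),\ \max\big\{g(x),f^{[m]}_n(x)\big\}\Big\}.$$ For $m=1$ one has $\Delta V^{[1]}_n(x)=V^{[1]}_n(x)=\max\{g(x),f^{[1]}_n(x)\}$ for all $n\ge0$ and $x>0$ (which is the same formula with the convention $f^{[0]}_n\equiv+\infty$).
   Context: Let $r\ge0$, $\alpha:=(1+r)^{-1}$, and $\lambda>1$ with $\lambda^{-1}<1+r<\lambda$. Put $p:=\frac{(1+r)-\lambda^{-1}}{\lambda-\lambda^{-1}}$, $q:=1-p$ (both in $(0,1)$). Let $K>0$ and $g(x):=(K-x)^+$ for $x>0$. For a function $\varphi$ on $(0,\infty)$ let $(\mathcal A\varphi)(x):=\alpha[p\,\varphi(\lambda x)+q\,\varphi(\lambda^{-1}x)]$. Define functions on $(0,\infty)$ recursively by $V^{[0]}_n\equiv0$ ($n\ge0$), $V^{[m]}_0=g$ ($m\ge1$), and, for $n,m\ge1$, $$V^{[m]}_n(x)=\max\{g(x)+(\mathcal AV^{[m-1]}_{n-1})(x),\ (\mathcal AV^{[m]}_{n-1})(x)\}.$$ For $m\ge1$ put $\Delta V^{[m]}_n:=V^{[m]}_n-V^{[m-1]}_n$ ($n\ge 0$), $f^{[m]}_n:=\mathcal A\,\Delta V^{[m]}_{n-1}$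 ($n\ge1$) and $f^{[m]}_0:=0$. $\operatorname{med}$ denotes the median of three real numbers. *)

(* Defs.v *)
From HB Require Import structures.
From mathcomp Require Import all_boot all_order all_algebra.
From mathcomp Require Import reals constructive_ereal.

Set Implicit Arguments.
Unset Strict Implicit.
Unset Printing Implicit Defensive.

Import Order.TTheory GRing.Theory Num.Theory.
Local Open Scope ring_scope.

(* Functions on (0, +oo) are represented by total functions R -> R. Since the
   argument x only ever gets multiplied by lambda or lambda^-1, the values at
   positive points depend only on values at positive points. *)

Definition discount (R : realType) (r : R) : R := (1 + r)^-1.

Definition pup (R : realType) (r lambda : R) : R :=
  ((1 + r) - lambda^-1) / (lambda - lambda^-1).

Definition pdown (R : realType) (r lambda : R) : R := 1 - pup r lambda.

Definition payoff (R : realType) (K : R) (x : R) : R := Num.max (K - x) 0.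

Definition Aop (R : realType) (r lambda : R) (phi : R -> R) (x : R) : R :=
  discount r *
  (pup r lambda * phi (lambda * x) + pdown r lambda * phi (lambda^-1 * x)).

(* V r lambda K m n is $V^{[m]}_n$: exercise rights m first, periods n second. *)
Fixpoint V (R : realType) (r lambda K : R) (m n : nat) {struct n} : R -> R :=
  match m, n with
  | 0, _ => fun=> 0
  | _.+1, 0 => payoff K
  | m'.+1, n'.+1 => fun x =>
      Num.max (payoff K x + Aop r lambda (V r lambda K m' n') x)
              (Aop r lambda (V r lambda K m n') x)
  end.

(* DeltaV and f are only meant for m >= 1 (at m = 0 the predecessor truncates
   and both are identically 0, which is not the convention f^{[0]} = +oo). *)
Definition DeltaV (R : realType) (r lambda K : R) (m n : nat) (x : R) : R :=
  V r lambda K m n x - V r lambda K m.-1 n x.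

Definition f (R : realType) (r lambda K : R) (m n : nat) : R -> R :=
  if n is n'.+1 then Aop r lambda (DeltaV r lambda K m n') else fun=> 0.

Definition med (d : Order.disp_t) (T : orderType d) (a b c : T) : T :=
  nth a (sort <=%O [:: a; b; c]) 1.

(* Main.v *)
(* Put a, b, c for the values A V^[m-2], A V^[m-1], A V^[m] at (n-1, x).  Pulling b
   out of the first maximum below and a out of the second,
     DeltaV^[m]_n = max (g + b, c) - max (g + a, b)
                  = f^[m-1] + max (g, f^[m]) - max (g, f^[m-1]),
   since f^[m] = c - b and f^[m-1] = b - a.  When f^[m] <= f^[m-1], this clamps g
   to [f^[m], f^[m-1]]. *)
Require Import Defs.
From HB Require Import structures.
From mathcomp Require Import all_boot all_order all_algebra.
From mathcomp Require Import reals constructive_ereal.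
From mathcomp Require Import ring lra.

Set Implicit Arguments.
Unset Strict Implicit.
Unset Printing Implicit Defensive.

Import Order.TTheory GRing.Theory Num.Theory.
Local Open Scope ring_scope.

(** Sorting puts [b] before, between or after the ordered pair [a], [c]; the middle entry is then
    [a], [b] or [c] respectively. *)
Lemma med_clamp (d : Order.disp_t) (T : orderType d) (a b c : T) :
  (a <= c)%O -> med a b c = Order.min c (Order.max b a).
Proof.
move=> ac; rewrite /med /sort /=.
case: (leP a b) => ab /=; first by case: (leP b c) => bc /=; rewrite ?ac.
by rewrite (ltW (lt_le_trans ab ac)) ac min_r.
Qed.

Lemma AopB (R : realType) (r lambda : R) (phi psi : R -> R) (x : R) :
  Aop r lambda (fun y => phi y - psi y) x =
  Aop r lambda phi x - Aop r lambda psi x.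
Proof. by rewrite /Aop; ring. Qed.

Lemma fS (R : realType) (r lambda K : R) (m n : nat) (x : R) :
  f r lambda K m n.+1 x =
  Aop r lambda (V r lambda K m n) x - Aop r lambda (V r lambda K m.-1 n) x.
Proof. exact: AopB. Qed.

(** [V] is structural in [n], so it reduces only after a case split on [n]. *)
Lemma V0 (R : realType) (r lambda K : R) (n : nat) (x : R) :
  V r lambda K 0 n x = 0.
Proof. by case: n. Qed.

Lemma Aop_V0 (R : realType) (r lambda K : R) (n : nat) (x : R) :
  Aop r lambda (V r lambda K 0 n) x = 0.
Proof. by rewrite /Aop !V0 !(mulr0, addr0). Qed.

Lemma payoff_ge0 (R : realType) (K x : R) : 0 <= payoff K x.
Proof. by rewrite le_max lexx orbT. Qed.

Lemma DeltaV_clamp (R : realType) (r lambda K : R) (m n : nat) (x : R) :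
  f r lambda K m.+2 n x <= f r lambda K m.+1 n x ->
  DeltaV r lambda K m.+2 n x =
  Num.min (f r lambda K m.+1 n x)
          (Num.max (payoff K x) (f r lambda K m.+2 n x)).
Proof.
case: n => [|n].
  (* At [n = 0] both values are the payoff, so the difference is 0; so is the right side, both [f]
     being 0. *)
  by move=> _; rewrite /DeltaV /= subrr max_l ?min_l ?payoff_ge0.
rewrite !fS /DeltaV /=.
set a := Aop _ _ (V _ _ _ m n) x; set b := Aop _ _ (V _ _ _ m.+1 n) x.
set c := Aop _ _ (V _ _ _ m.+2 n) x; set g := payoff K x => fle.
(* These comparisons resolve every [max] and [min]; with [fle], that is [c - b <= b - a], each case
   is linear. *)
case: (leP (g + b) c) => h1; case: (leP (g + a) b) => h2;
  case: (leP g (c - b)) => h3; case: leP => h4; lra.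
Qed.

Lemma V1E (R : realType) (r lambda K : R) (n : nat) (x : R) :
  V r lambda K 1 n x = Num.max (payoff K x) (f r lambda K 1 n x).
Proof.
case: n => [|n]; first by rewrite /= max_l ?payoff_ge0.
(* As [V] vanishes without exercise rights, [f] is here the continuation value itself. *)
by rewrite fS /= Aop_V0 addr0 subr0.
Qed.

Theorem lemma3p4 (R : realType) (r lambda K : R)
    (hr : 0 <= r) (hlambda : 1 < lambda)
    (hdown : lambda^-1 < 1 + r) (hup : 1 + r < lambda) (hK : 0 < K) :
  (forall (n m : nat) (x : R), (2 <= m)%N -> 0 < x ->
     f r lambda K m n x <= f r lambda K m.-1 n x ->
     DeltaV r lambda K m n x =
       med (f r lambda K m n x) (payoff K x) (f r lambda K m.-1 n x) /\
     med (f r lambda K m n x) (payoff K x) (f r lambda K m.-1 n x) =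
       Num.min (f r lambda K m.-1 n x)
               (Num.max (payoff K x) (f r lambda K m n x))) /\
  (forall (n : nat) (x : R), 0 < x ->
     [/\ DeltaV r lambda K 1 n x = V r lambda K 1 n x,
         V r lambda K 1 n x = Num.max (payoff K x) (f r lambda K 1 n x),
         (DeltaV r lambda K 1 n x)%:E =
           med (f r lambda K 1 n x)%:E (payoff K x)%:E +oo%E
       & med (f r lambda K 1 n x)%:E (payoff K x)%:E +oo%E =
           Order.min +oo%E
             (Order.max (payoff K x)%:E (f r lambda K 1 n x)%:E)]).
Proof.
split=> [n [|[|m]] x // _ _ fle|n x _].
  by rewrite med_clamp // DeltaV_clamp.
have DV : DeltaV r lambda K 1 n x = V r lambda K 1 n x.
  by rewrite /DeltaV V0 subr0.
(* With [+oo] as $f^{[0]}$, the order hypothesis of the clamp is automatic and the outer [min] drops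
   out. *)
have medE := med_clamp (payoff K x)%:E (leey (f r lambda K 1 n x)%:E).
by split=> //; [exact: V1E | rewrite medE DV V1E EFin_max min_r ?leey].
Qed.
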